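(* Let $\ell>0$ and let $C_\ell$ be the circle of circumference $\ell$, equipped with either its intrinsic (arc-length) metric or its subspace metric as a round circle in $\mathbb{R}^2$; denote the metric by $d$. Then the magnitude of $C_\ell$ is given, for any $y\in C_\ell$, by $$|C_\ell|=\frac{\ell}{\int_0^{\ell}e^{-d(x,y)}\,dx},$$ where $x\in[0,\ell)$ denotes the arc-length parameter on $C_\ell$.
   Context: A weight measure on a metric space $(X,d)$ is a finite signed Borel measure $\nu$ on $X$ such that $\int_{x\in X}e^{-d(x,y)}\,d\nu(x)=1$ for all $y\in X$. If a weight measure $\nu$ exists on $X$, the magnitude of $X$ is defined to be its total mass $|X|:=\nu(X)$ (which does not depend on the choice of weight measure). *)

(* Defs.v *)
From HB Require Import structures.
From mathcomp Require Import all_boot all_order all_algebra.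
From mathcomp Require Import ring lra.
From mathcomp Require Import all_classical all_reals all_analysis.

Set Implicit Arguments.
Unset Strict Implicit.
Unset Printing Implicit Defensive.

Import Order.TTheory GRing.Theory Num.Theory.
Import numFieldNormedType.Exports.

Local Open Scope classical_set_scope.
Local Open Scope ring_scope.

(* The base point only serves to build the Borel [measurableType] below, since
   every [measurableType] is pointed. *)
#[short(type="pointedMetricType")]
HB.structure Definition PointedMetric (K : numDomainType) :=
  {T of Pointed T & Metric K T}.

Definition borel (R : realType) (X : pointedMetricType R) :=
  g_sigma_algebraType (@open X).

(* The integral against the finite signed measure [nu] is the difference of the
   integrals against its positive and negative parts; the Hahn decomposition is
   unique up to null sets, so the value does not depend on the one chosen. *)
Definition charge_integral d (T : measurableType d) (R : realType)
    (nu : {charge set T -> \bar R}) (f : T -> \bar R) : \bar R :=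
  let P := cid (Hahn_decomposition nu) in
  let N := cid (svalP P) in
  (\int[jordan_pos (svalP N)]_x f x - \int[jordan_neg (svalP N)]_x f x)%E.

Definition weight_measure (R : realType) (X : pointedMetricType R)
    (nu : {charge set (borel X) -> \bar R}) : Prop :=
  forall y : X,
    charge_integral nu (fun x : borel X => (expR (- mdist (x : X) y))%:E) = 1%E.

(* [X] has a weight measure and its magnitude is [m]; that the total mass does
   not depend on the weight measure is part of the predicate. *)
Definition has_magnitude (R : realType) (X : pointedMetricType R) (m : R) :
    Prop :=
  (exists nu : {charge set (borel X) -> \bar R}, weight_measure nu) /\
  (forall nu : {charge set (borel X) -> \bar R},
     weight_measure nu -> nu [set: borel X] = m%:E).

Section circle.
Context {R : realType}.
Implicit Types l s t u : R.

Definition radius l : R := l / (2 * pi).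

Definition in_circle l (p : R * R) := p.1 ^+ 2 + p.2 ^+ 2 == radius l ^+ 2.

Definition circle l : Type := {p : R * R | in_circle l p}.

Lemma circle_param_subproof l t :
  in_circle l (radius l * cos (t / radius l), radius l * sin (t / radius l)).
Proof. by rewrite /in_circle /= !exprMn -mulrDr cos2Dsin2 mulr1. Qed.

(* Parametrization of the circle by arc length. *)
Definition circle_param l t : circle l :=
  exist (in_circle l) _ (circle_param_subproof l t).

(* Euclidean distance in the plane. *)
Definition chord_dist l (p q : circle l) : R :=
  Num.sqrt (((val p).1 - (val q).1) ^+ 2 + ((val p).2 - (val q).2) ^+ 2).

(* Length of a shortest arc from [p] to [q]. *)
Definition arc_dist l (p q : circle l) : R :=
  inf [set x | exists s t,
         [/\ circle_param l s = p, circle_param l t = q & x = `|s - t|]].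

Let circle_eq l (p q : circle l) :
  (val p).1 = (val q).1 -> (val p).2 = (val q).2 -> p = q.
Proof.
by case: p q => -[a b] ? [[c d] ?] /= h1 h2; apply: val_inj => /=; congr pair.
Qed.

Lemma chord_distxx l (p : circle l) : chord_dist p p = 0.
Proof. by rewrite /chord_dist !subrr expr0n /= addr0 sqrtr0. Qed.

Lemma chord_dist_eq0 l (p q : circle l) : chord_dist p q = 0 -> p = q.
Proof.
move=> /eqP; rewrite sqrtr_eq0 => h.
have a0 := sqr_ge0 ((val p).1 - (val q).1).
have b0 := sqr_ge0 ((val p).2 - (val q).2).
have /eqP : ((val p).1 - (val q).1) ^+ 2 = 0 by lra.
have /eqP : ((val p).2 - (val q).2) ^+ 2 = 0 by lra.
by rewrite !sqrf_eq0 !subr_eq0 => /eqP h2 /eqP h1; exact: circle_eq.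
Qed.

Lemma chord_distC l (p q : circle l) : chord_dist p q = chord_dist q p.
Proof. by congr (Num.sqrt (_ + _)); rewrite -sqrrN opprB. Qed.

Lemma sqrt_minkowski (a b c d : R) :
  Num.sqrt ((a + c) ^+ 2 + (b + d) ^+ 2) <=
  Num.sqrt (a ^+ 2 + b ^+ 2) + Num.sqrt (c ^+ 2 + d ^+ 2).
Proof.
have uge : 0 <= a ^+ 2 + b ^+ 2 by rewrite addr_ge0 ?sqr_ge0.
have vge : 0 <= c ^+ 2 + d ^+ 2 by rewrite addr_ge0 ?sqr_ge0.
have u0 := sqrtr_ge0 (a ^+ 2 + b ^+ 2); have v0 := sqrtr_ge0 (c ^+ 2 + d ^+ 2).
rewrite -[leRHS]ger0_norm ?addr_ge0// -sqrtr_sqr ler_wsqrtr//.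
rewrite [leRHS]sqrrD !sqr_sqrtr//.
suff : a * c + b * d <=
    Num.sqrt (a ^+ 2 + b ^+ 2) * Num.sqrt (c ^+ 2 + d ^+ 2).
  by move=> h; rewrite mulr2n; nra.
rewrite -sqrtrM//; apply: (le_trans (ler_norm _)).
rewrite -sqrtr_sqr ler_wsqrtr//.
by have := sqr_ge0 (a * d - b * c); nra.
Qed.

Lemma chord_dist_triangle l (q p r : circle l) :
  chord_dist p r <= chord_dist p q + chord_dist q r.
Proof.
rewrite /chord_dist; apply: le_trans (sqrt_minkowski _ _ _ _).
by rewrite !addrA !subrK.
Qed.

Lemma circle_paramP l (p : circle l) : exists t, circle_param l t = p.
Proof.
case: p => -[a b] h; have /eqP /= hab := h.
have [r0|r0] := eqVneq (radius l) 0.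
  exists 0; apply: val_inj => /=; move: hab; rewrite r0 expr0n /= => hab.
  have a0 := sqr_ge0 a; have b0 := sqr_ge0 b.
  have /eqP : a ^+ 2 = 0 by lra.
  have /eqP : b ^+ 2 = 0 by lra.
  by rewrite !sqrf_eq0 => /eqP -> /eqP ->; rewrite !mul0r.
move: r0 hab; move rE : (radius l) => r r0 hab.
set c := a / r; set s := b / r.
have cs : c ^+ 2 + s ^+ 2 = 1.
  by rewrite /c /s !expr_div_n -mulrDl hab divff// expf_neq0.
have c1 : -1 <= c <= 1 by have s2 := sqr_ge0 s; apply/andP; split; nra.
have ca : cos (acos c) = c by rewrite acosK// in_itv.
have sa : sin (acos c) = `|s|.
  rewrite sin_acos//; have -> : 1 - c ^+ 2 = s ^+ 2 by lra.
  by rewrite sqrtr_sqr.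
have [s0|s0] := leP 0 s.
  exists (r * acos c); apply: val_inj => /=; rewrite rE mulrAC divff// mul1r.
  by rewrite ca sa ger0_norm// /c /s !(mulrC r) !divfK.
exists (- (r * acos c)); apply: val_inj => /=.
rewrite rE mulNr mulrAC divff// mul1r cosN sinN ca sa ltr0_norm// opprK.
by rewrite /c /s !(mulrC r) !divfK.
Qed.

Lemma circle_param_shift l s t u : circle_param l t = circle_param l u ->
  circle_param l (s + (u - t)) = circle_param l s.
Proof.
have [r0|r0] := eqVneq (radius l) 0.
  by move=> _; apply: val_inj => /=; rewrite r0 !mul0r.
move=> /(congr1 val)[/(mulfI r0) ct /(mulfI r0) st].
have cut : cos ((u - t) / radius l) = 1.
  by rewrite mulrBl cosB ct st -!expr2 cos2Dsin2.
have sut : sin ((u - t) / radius l) = 0.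
  by rewrite mulrBl sinB ct st mulrC subrr.
apply: val_inj => /=.
by rewrite mulrDl cosD sinD cut sut !mulr1 !mulr0 subr0 addr0.
Qed.

Let arcs l (p q : circle l) : set R :=
  [set x | exists s t,
     [/\ circle_param l s = p, circle_param l t = q & x = `|s - t|]].

Let arcs_inf l (p q : circle l) : has_inf (arcs p q).
Proof.
split.
  have [s sp] := circle_paramP p; have [t tq] := circle_paramP q.
  by exists `|s - t|, s, t.
by exists 0 => _ [s [t [_ _ ->]]].
Qed.

Let le_arc_dist l (p q : circle l) (x : R) :
  (forall s t, circle_param l s = p -> circle_param l t = q -> x <= `|s - t|) ->
  x <= arc_dist p q.
Proof.
move=> h; apply: lb_le_inf; first by have [] := arcs_inf p q.
by move=> _ [s [t [sp tq ->]]]; exact: h.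
Qed.

Lemma arc_dist_le l s t :
  arc_dist (circle_param l s) (circle_param l t) <= `|s - t|.
Proof.
apply: ge_inf; last by exists s, t.
by have [] := arcs_inf (circle_param l s) (circle_param l t).
Qed.

Lemma arc_dist_ge0 l (p q : circle l) : 0 <= arc_dist p q.
Proof. exact: le_arc_dist. Qed.

Lemma arc_distxx l (p : circle l) : arc_dist p p = 0.
Proof.
apply/eqP; rewrite eq_le arc_dist_ge0 andbT.
by have [s <-] := circle_paramP p; rewrite (le_trans (arc_dist_le _ _ _))//
  subrr normr0.
Qed.

Let lip_cos (a b : R) : `|cos a - cos b| <= `|a - b|.
Proof.
wlog ab : a b / b <= a => [h|].
  by have [/h//|/ltW/h] := leP b a; rewrite distrC (distrC b).
have [|z _ ->] := @MVT_segment R cos (- sin) b a ab.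
  exact/continuous_subspaceT/continuous_cos.
by rewrite normrM ler_piMl// normrN sin_max.
Qed.

Let lip_sin (a b : R) : `|sin a - sin b| <= `|a - b|.
Proof.
by rewrite -!cosBpihalf (le_trans (lip_cos _ _))// opprB addrA subrK.
Qed.

Lemma arc_dist_eq0 l (p q : circle l) : arc_dist p q = 0 -> p = q.
Proof.
move=> pq.
have lip (f : R -> R) : (forall a b, `|f a - f b| <= `|a - b|) ->
    forall s t, `|radius l * f (s / radius l) - radius l * f (t / radius l)|
      <= `|s - t|.
  move=> lf s t; have [->|r0] := eqVneq (radius l) 0.
    by rewrite !mul0r subrr normr0.
  rewrite -mulrBr normrM (le_trans (ler_wpM2l _ (lf _ _)))//.
  by rewrite -normrM -mulrBl mulrC divfK.
have h1 : `|(val p).1 - (val q).1| <= 0.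
  by rewrite -pq; apply: le_arc_dist => s t <- <- /=; exact: lip lip_cos _ _.
have h2 : `|(val p).2 - (val q).2| <= 0.
  by rewrite -pq; apply: le_arc_dist => s t <- <- /=; exact: lip lip_sin _ _.
move: h1 h2; rewrite !normr_le0 !subr_eq0 => /eqP h1 /eqP h2.
exact: circle_eq.
Qed.

Lemma arc_distC l (p q : circle l) : arc_dist p q = arc_dist q p.
Proof.
by congr inf; apply/seteqP; split => _ [s [t [sp tq ->]]]; exists t, s;
  rewrite distrC.
Qed.

Lemma arc_dist_triangle l (q p r : circle l) :
  arc_dist p r <= arc_dist p q + arc_dist q r.
Proof.
rewrite -lerBlDr; apply: le_arc_dist => s t sp tq.
rewrite lerBlDr -lerBlDl; apply: le_arc_dist => t' u tq' ur.
rewrite lerBlDl -sp -ur.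
rewrite -(@circle_param_shift l s t t'); last by rewrite tq tq'.
apply: (le_trans (arc_dist_le _ _ _)).
have -> : s + (t' - t) - u = (s - t) + (t' - u) by ring.
exact: ler_normD.
Qed.

End circle.

(* Two copies of the carrier, since a type holds only one metric structure. *)
Definition arc_circle (R : realType) (l : R) : Type := circle l.
Definition chord_circle (R : realType) (l : R) : Type := circle l.

HB.instance Definition _ (R : realType) (l : R) := Choice.on (arc_circle l).
HB.instance Definition _ (R : realType) (l : R) :=
  isPointed.Build (arc_circle l) (circle_param l 0).
HB.instance Definition _ (R : realType) (l : R) :=
  isMetric.Build R (arc_circle l) (@arc_distxx R l) (@arc_dist_eq0 R l)
    (@arc_distC R l) (@arc_dist_triangle R l).

HB.instance Definition _ (R : realType) (l : R) := Choice.on (chord_circle l).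
HB.instance Definition _ (R : realType) (l : R) :=
  isPointed.Build (chord_circle l) (circle_param l 0).
HB.instance Definition _ (R : realType) (l : R) :=
  isMetric.Build R (chord_circle l) (@chord_distxx R l) (@chord_dist_eq0 R l)
    (@chord_distC R l) (@chord_dist_triangle R l).

(* Main.v *)
Require Import Defs.
From HB Require Import structures.
From mathcomp Require Import all_boot all_order all_algebra.
From mathcomp Require Import ring lra.
From mathcomp Require Import all_classical all_reals all_analysis.
From mathcomp Require Import measurable_realfun.

Set Implicit Arguments.
Unset Strict Implicit.
Unset Printing Implicit Defensive.

Import Order.TTheory GRing.Theory Num.Theory.
Import numFieldNormedType.Exports.

Local Open Scope classical_set_scope.
Local Open Scope ring_scope.

(** The circle is homogeneous for both metrics: rotations are isometries and act
    transitively. So the arc-length measure [mu] has the same potential [c], the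
    integral of [expR (- d)] against [mu], at every point, and [mu / c] is a
    weight measure, of mass [l / c].

    That every weight measure [nu] has this mass follows from the symmetry of
    the kernel: integrating [expR (- d(x, y))] against [nu] and [mu] gives
    [mu X = l] when [nu] is integrated first, and [c * nu X] when [mu] is.
    [magnitude_constant_potential] is this argument for any separable metric
    space carrying a finite measure of constant positive potential; separability
    provides the joint measurability of the distance ([measurable_mdist]) that
    exchanging the integrals needs, and the exchange is made for the positive
    and negative parts of [nu] separately.

    [magnitude_closed_curve] supplies such a measure for a space swept out by a
    periodic 1-Lipschitz curve for which shifting the parameter preserves
    distances; the constancy of the potential is the invariance under
    translation of the integral of a periodic function over one period
    ([Rintegral_periodic]). The arc and the chord metric both satisfy its
    hypotheses. *)

(** * Integration against a charge that is a measure *)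

(** A nonnegative charge vanishes on every part of the negative set of a Hahn
    decomposition, whichever decomposition was chosen; so its positive part is
    the charge itself and its negative part is zero. *)
Lemma charge_integral_measure d (T : measurableType d) (R : realType)
    (nu : {charge set T -> \bar R}) (m : {measure set T -> \bar R})
    (f : T -> \bar R) :
  (forall A, measurable A -> nu A = m A) ->
  charge_integral nu f = (\int[m]_x f x)%E.
Proof.
move=> num; rewrite /charge_integral.
case: cid => P /= PN; case: cid => N /= hahn.
have [[mP _] [mN negN] PUN PIN] := hahn.
have nuN A : measurable A -> nu (A `&` N) = 0%E.
  move=> mA; have mAN : measurable (A `&` N) by exact: measurableI.
  by apply/eqP; rewrite eq_le negN//= num.
have posE A : measurable A -> jordan_pos hahn A = m A.
  move=> mA; rewrite jordan_posE cjordan_posE /crestr0 mem_set// /crestr -num//.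
  rewrite -[in RHS](setIT A) -PUN setIUr chargeU ?nuN ?adde0//.
  - exact: measurableI.
  - exact: measurableI.
  - by rewrite setIACA PIN setI0.
have negE A : measurable A -> jordan_neg hahn A = 0%E.
  move=> mA; rewrite jordan_negE cjordan_negE /crestr0 mem_set// /crestr.
  by rewrite nuN// oppe0.
rewrite (eq_measure_integral m) => [|A mA _]; last exact: posE.
rewrite [X in (_ - X)%E](eq_measure_integral mzero) => [|A mA _]; last first.
  exact: negE.
by rewrite integral_measure_zero sube0.
Qed.

(** * The exponential kernel of a separable metric space *)

Lemma open_borel (R : realType) (X : pointedMetricType R) (A : set X) :
  open A -> measurable (A : set (borel X)).
Proof. by move=> oA; apply: sub_sigma_algebra. Qed.

Lemma continuous_borel_measurable (R : realType) (X : pointedMetricType R)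
    (g : R -> X) : continuous g -> measurable_fun setT (g : R -> borel X).
Proof.
move=> /continuousP cg.
apply: (@measurability _ _ _ (borel X) _ _ (@open X)) => // _ [A oA <-].
by rewrite setTI; apply: open_measurable; exact: cg.
Qed.

Lemma mdist_ball_open (R : realType) (X : metricType R) (x : X) (r : R) :
  open (ball x r).
Proof.
rewrite openE => y; rewrite ballEmdist /interior -nbhs_ballE => /= xyr.
exists (r - mdist x y) => /=; first by rewrite subr_gt0.
move=> z; rewrite ballEmdist /= => yz.
by have := metric_triangle x y z; lra.
Qed.

(** Separability is what makes the distance measurable for the product of the
    Borel sigma-algebras, which may be smaller than the Borel sigma-algebra of
    the product: [mdist x y < a] says that some point [s k] of the dense
    sequence, close enough to [y], shows it through the triangle inequality, so
    the sublevel set is a countable union of rectangles of balls. *)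
Lemma measurable_mdist (R : realType) (X : pointedMetricType R) (s : nat -> X) :
  dense (range s) ->
  measurable_fun setT (fun z : borel X * borel X => mdist (z.1 : X) (z.2 : X)).
Proof.
move=> ds; apply: (measurability (@RGenInftyO.G R)).
  exact: RGenInftyO.measurableE.
move=> _ [_ [a ->] <-]; rewrite setTI.
rewrite (_ : _ @^-1` _ = \bigcup_n \bigcup_k
    ((ball (s k) (a - n.+1%:R^-1) : set (borel X)) `*`
     (ball (s k) n.+1%:R^-1 : set (borel X)))).
  apply: bigcup_measurable => n _; apply: bigcup_measurable => k _.
  by apply: measurableX; apply: open_borel; exact: mdist_ball_open.
apply/seteqP; split => [[x y]|[x y] [n _ [k _ []]]] /=; last first.
  rewrite !ballEmdist !in_itv/= => h1 h2.
  rewrite (le_lt_trans (metric_triangle (x : X) (s k) y))//.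
  by rewrite -(subrK n.+1%:R^-1 a) ltrD// metric_sym.
rewrite in_itv/=; set D := mdist _ _ => Da.
(* Both balls lose a margin of 1/(n+1), hence the half of the room left. *)
have e0 : 0 < (a - D) / 2 by lra.
have [n _ /(_ n (leqnn n)) /= ne] := near_infty_natSinv_lt (PosNum e0).
have n0 : 0 < n.+1%:R^-1 :> R by rewrite invr_gt0.
have [] := ds (ball (y : X) n.+1%:R^-1).
- by exists y; exact: (ballxx (y : X)).
- exact: mdist_ball_open.
move=> z [yk [k _ skE]]; rewrite -{z}skE in yk; exists n => //; exists k => //.
move: yk; rewrite !ballEmdist/= (metric_sym (y : X)) => yk.
split; last exact: yk.
rewrite (le_lt_trans (metric_triangle (s k) (y : X) x))//.
rewrite (metric_sym (y : X)) -/D.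
by move: n.+1%:R^-1 (mdist (s k) _) ne yk => e E ne yk; lra.
Qed.

Definition exp_kernel (R : realType) (X : pointedMetricType R) (x y : borel X) :
  \bar R := (expR (- mdist (x : X) (y : X)))%:E.

Lemma exp_kernel_ge0 (R : realType) (X : pointedMetricType R) (x y : borel X) :
  (0 <= exp_kernel x y)%E.
Proof. by rewrite lee_fin expR_ge0. Qed.

Lemma exp_kernelC (R : realType) (X : pointedMetricType R) (x y : borel X) :
  exp_kernel x y = exp_kernel y x.
Proof. by rewrite /exp_kernel metric_sym. Qed.

Lemma measurable_exp_kernel (R : realType) (X : pointedMetricType R)
    (s : nat -> X) : dense (range s) ->
  measurable_fun setT (fun z : borel X * borel X => exp_kernel z.1 z.2).
Proof.
move=> ds; apply/measurable_EFinP; apply: measurableT_comp => //.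
by apply: measurableT_comp => //; exact: measurable_mdist ds.
Qed.

Lemma measurable_exp_kernel_l (R : realType) (X : pointedMetricType R)
    (y : borel X) : measurable_fun setT (fun x => exp_kernel x y).
Proof.
apply/measurable_EFinP; apply: measurableT_comp => //.
apply: measurableT_comp => //; apply: (measurability (@RGenInftyO.G R)).
  exact: RGenInftyO.measurableE.
move=> _ [_ [a ->] <-]; rewrite setTI.
rewrite (_ : _ @^-1` _ = ball (y : X) a).
  by apply: open_borel; exact: mdist_ball_open.
by apply/seteqP; split => x; rewrite ballEmdist/= in_itv/= metric_sym.
Qed.

Lemma potential_lty (R : realType) (X : pointedMetricType R)
    (p : {finite_measure set (borel X) -> \bar R}) (y : borel X) :
  (\int[p]_x exp_kernel x y < +oo)%E.
Proof.
apply: (@le_lt_trans _ _ (\int[p]_x cst 1%E x)%E).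
  apply: ge0_le_integral => //.
  - by move=> x _; exact: exp_kernel_ge0.
  - exact: measurable_exp_kernel_l.
  - by move=> x _; rewrite lee_fin -expR0 ler_expR oppr_le0 mdist_ge0.
by rewrite integral_cst// mul1e ltey_eq fin_num_measure.
Qed.

Lemma measurable_potential (R : realType) (X : pointedMetricType R)
    (s : nat -> X) (p : {finite_measure set (borel X) -> \bar R}) :
  dense (range s) ->
  measurable_fun setT (fun y : borel X => \int[p]_x exp_kernel x y)%E.
Proof.
move=> ds.
apply: (measurable_fun_fubini_tonelli_G (fun z => exp_kernel z.1 z.2)).
- exact: measurable_exp_kernel ds.
- by move=> z; exact: exp_kernel_ge0.
Qed.

(** * Magnitude from a measure of constant potential *)

(** The double integral of the kernel against [mu] and [p] can be computed in
    either order; integrating against [mu] first gives the constant [c]. *)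
Lemma integral_potential (R : realType) (X : pointedMetricType R)
    (s : nat -> X) (mu p : {finite_measure set (borel X) -> \bar R}) (c : R) :
  dense (range s) -> (forall y, \int[mu]_x exp_kernel x y = c%:E)%E ->
  (\int[mu]_y \int[p]_x exp_kernel x y = c%:E * p setT)%E.
Proof.
move=> ds muc.
rewrite -(fubini_tonelli (fun z => exp_kernel z.1 z.2))/=.
- under eq_integral do under eq_integral do rewrite exp_kernelC.
  under eq_integral do rewrite muc.
  by rewrite integral_cst.
- exact: measurable_exp_kernel ds.
- by move=> z; exact: exp_kernel_ge0.
Qed.

(** Dividing [mu] by [c] gives a weight measure. Conversely, let [nu] be a
    weight measure with Jordan parts [p] and [q]: the potential of [p] exceeds
    that of [q] by exactly 1 at every point, so integrating both against [mu] yields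
    [c * p X = c * q X + mu X], which determines [nu X = p X - q X]. *)
Lemma magnitude_constant_potential (R : realType) (X : pointedMetricType R)
    (s : nat -> X) (mu : {finite_measure set (borel X) -> \bar R}) (c : R) :
  dense (range s) -> 0 < c -> (forall y, \int[mu]_x exp_kernel x y = c%:E)%E ->
  has_magnitude X (fine (mu setT) / c).
Proof.
move=> ds c0 muc; split.
  exists (cscale c^-1 (charge_of_finite_measure mu)) => y.
  have ci0 : 0 <= c^-1 by rewrite invr_ge0 ltW.
  rewrite (charge_integral_measure (m := mscale (NngNum ci0) mu))//.
  rewrite ge0_integral_mscale//=.
    by rewrite (muc y) -EFinM mulVf// gt_eqF.
  exact: measurable_exp_kernel_l.
move=> nu; rewrite /weight_measure /charge_integral.
case: cid => P /= PN; case: cid => N /= hahn nu1.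
set p : {finite_measure set (borel X) -> \bar R} := jordan_pos hahn.
set q : {finite_measure set (borel X) -> \bar R} := jordan_neg hahn.
have pE y : (\int[p]_x exp_kernel x y = \int[q]_x exp_kernel x y + 1)%E.
  have := nu1 y; rewrite -/p -/q => <-; rewrite addeC subeK// ge0_fin_numE.
    exact: potential_lty.
  by apply: integral_ge0 => x _; exact: exp_kernel_ge0.
have := integral_potential p ds muc.
under eq_integral do rewrite pE.
rewrite ge0_integralD//=; last 2 first.
- by move=> y _; apply: integral_ge0 => x _; exact: exp_kernel_ge0.
- exact: measurable_potential ds.
rewrite (integral_potential q ds muc) integral_cst// mul1e => cpq.
rewrite (jordan_decomp hahn)//.
rewrite [LHS](_ : _ = p setT - q setT)%E; last by rewrite /cadd/= cscaleN1.
have solve (a b m : \bar R) : a \is a fin_num -> b \is a fin_num ->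
    m \is a fin_num -> (c%:E * b + m = c%:E * a -> a - b = (fine m / c)%:E)%E.
  move: a b m => [a| |] [b| |] [m| |]//= _ _ _ abE; have ab := EFin_inj abE.
  rewrite -EFinB; congr EFin; apply: (@mulfI _ c); first by rewrite gt_eqF.
  by rewrite mulrBr -ab addrAC subrr add0r mulrC divfK// gt_eqF.
by apply: solve => //; exact: fin_num_measure.
Qed.

(** * Integrals of periodic functions *)

Lemma Rintegral_shift (R : realType) (f : R -> R) (a b c : R) :
  a <= b -> continuous f ->
  \int[lebesgue_measure]_(t in `[a + c, b + c]) f t =
  \int[lebesgue_measure]_(t in `[a, b]) f (t + c).
Proof.
move=> ab cf; rewrite /Rintegral; congr fine.
have dF x : is_derive x (1 : R) (fun t : R => t + c) 1.
  by apply: is_derive_eq; rewrite addr0.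
have F'1 : derive1 (fun t : R => t + c) = cst 1.
  by apply/funext => x; rewrite derive1E derive_val.
rewrite (@integration_by_substitution_increasing R (fun t => t + c) f a b ab).
- by apply: eq_integral => x _; rewrite F'1 /= mulr1.
- by move=> x y _ _; rewrite ltrD2r.
- by move=> x _; rewrite F'1; exact: cst_continuous.
- by rewrite F'1; exact: is_cvg_cst.
- by rewrite F'1; exact: is_cvg_cst.
- have cF : continuous (fun t : R => t + c).
    by move=> x; apply: cvgD => //; exact: cvg_cst.
  split => [x _||].
  + by [].
  + exact/cvg_at_right_filter/cF.
  + exact/cvg_at_left_filter/cF.
- exact: continuous_subspaceT.
Qed.

Lemma continuous_itv_integrable (R : realType) (f : R -> R) (a b : R) :
  continuous f ->
  lebesgue_measure.-integrable `[a, b]%classic (EFin \o f).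
Proof.
move=> cf; apply: continuous_compact_integrable; first exact: segment_compact.
exact: continuous_subspaceT.
Qed.

Lemma periodicz (R : realType) (f : R -> R) (l : R) (k : int) (t : R) :
  periodic f l -> f (t + k%:~R * l) = f t.
Proof.
move=> fl; case: k => n; first by rewrite -pmulrn mulr_natl periodicn.
by rewrite -(periodicn fl n.+1) NegzE mulrNz mulNr -pmulrn mulr_natl subrK.
Qed.

Lemma Rintegral_setU_itv (R : realType) (f : R -> R) (a b c : R) :
  continuous f -> a <= b -> b <= c ->
  \int[lebesgue_measure]_(t in `[a, c]) f t =
  \int[lebesgue_measure]_(t in `[a, b]) f t +
  \int[lebesgue_measure]_(t in `[b, c]) f t.
Proof.
move=> cf ab bc; have := @Rintegral_itvB R f (BLeft a) (BRight c) b.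
rewrite !bnd_simp => /(_ (continuous_itv_integrable _ _ cf) ab bc).
rewrite Rintegral_itv_obnd_cbnd => [<-|]; first by rewrite addrC subrK.
apply: integrableS (continuous_itv_integrable b c cf) => //.
by apply: subset_itvr; rewrite bnd_simp.
Qed.

(** Reduce the shift modulo [l] to some [v] in [[0, l]]; the window [[v, l + v]]
    is then [[0, l]] with the piece [[0, v]] moved by one period to
    [[l, l + v]]. *)
Lemma Rintegral_periodic (R : realType) (f : R -> R) (l u : R) :
  0 < l -> continuous f -> periodic f l ->
  \int[lebesgue_measure]_(t in `[0, l]) f (t + u) =
  \int[lebesgue_measure]_(t in `[0, l]) f t.
Proof.
move=> l0 cf fl.
set k := Num.floor (u / l); set v := u - k%:~R * l.
have v0 : 0 <= v by rewrite subr_ge0 -ler_pdivlMr// floor_le.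
have vl : v <= l.
  rewrite lerBlDl -[X in _ + X]mul1r -mulrDl -ler_pdivrMr//.
  by rewrite -(intrD _ _ 1) ltW// floorD1_gt.
have uv t : f (t + u) = f (t + v).
  by rewrite -(periodicz k (t + v) fl) /v -addrA subrK.
under eq_Rintegral do rewrite uv.
rewrite -Rintegral_shift// ?ltW// add0r.
rewrite (@Rintegral_setU_itv _ _ v l (l + v))//; last by rewrite lerDl.
rewrite [l + v]addrC.
rewrite -{2}[l]add0r Rintegral_shift//.
under [X in _ + X]eq_Rintegral do rewrite fl.
by rewrite addrC -Rintegral_setU_itv.
Qed.

(** * Closed curves with a transitive group of translations *)

Lemma ge0_integral_mfrestr d (T : measurableType d) (R : realType)
    (mu : {measure set T -> \bar R}) (D : set T) (mD : measurable D)
    (muD : (mu D < +oo)%E) (h : T -> \bar R) :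
  measurable_fun setT h -> (forall x, 0 <= h x)%E ->
  (\int[mfrestr mD muD]_x h x = \int[mu]_(x in D) h x)%E.
Proof.
move=> mh h0.
rewrite (@ge0_negligible_integral _ _ _ (mfrestr mD muD) setT (~` D))//.
- rewrite setTD setCK; apply: eq_measure_integral => A mA AD.
  by rewrite /= /mfrestr /mrestr setIidl.
- exact: measurableC.
- by rewrite /= /mfrestr /mrestr setICl measure0.
Qed.

(** The image of a restricted measure, packed as an existential so that the
    finite measure can be used without the proofs it is built from. *)
Lemma finite_image_measure d1 d2 (T1 : measurableType d1)
    (T2 : measurableType d2) (R : realType) (mu : {measure set T1 -> \bar R})
    (D : set T1) (g : T1 -> T2) :
  measurable D -> (mu D < +oo)%E -> measurable_fun setT g ->
  exists p : {finite_measure set T2 -> \bar R}, p setT = mu D /\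
    forall h : T2 -> \bar R, measurable_fun setT h -> (forall x, 0 <= h x)%E ->
      (\int[p]_x h x = \int[mu]_(x in D) h (g x))%E.
Proof.
move=> mD muD mg; pose muD' := mfrestr mD muD.
have [p pE] : exists p : {measure set T2 -> \bar R},
    forall A, p A = pushforward muD' g A.
  by unshelve eexists (pushforward muD' g).
have pT : (p setT < +oo)%E.
  by rewrite pE /pushforward preimage_setT ltey_eq fin_num_measure.
exists (mfrestr measurableT pT); split => [|h mh h0].
  rewrite /= /mfrestr /mrestr setIT pE /pushforward preimage_setT.
  by rewrite /muD' /= /mfrestr /mrestr setTI.
rewrite ge0_integral_mfrestr// -(ge0_integral_mfrestr mD muD); last 2 first.
- exact: measurableT_comp.
- by move=> x; exact: h0.
rewrite -[RHS](ge0_integral_pushforward mg muD' measurableT)//.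
by have -> : (p : set T2 -> \bar R) = pushforward muD' g by exact/funext.
Qed.

(** The image under [g] of the Lebesgue measure on one period has constant
    potential: shifting the parameter carries any point [g u] to [g 0] without
    changing distances, and an integral over a period does not see the shift.
    Its mass is [l], and the space is separable as the continuous image of the
    line. *)
Lemma magnitude_closed_curve (R : realType) (X : pointedMetricType R)
    (g : R -> X) (l : R) :
  0 < l ->
  (forall s t, mdist (g s) (g t) <= `|s - t|) ->
  (forall t, g (t + l) = g t) ->
  (forall s t w, mdist (g (s + w)) (g (t + w)) = mdist (g s) (g t)) ->
  (forall x, exists t, g t = x) ->
  forall y, has_magnitude X
    (l / \int[lebesgue_measure]_(t in `[0, l[) expR (- mdist (g t) y)).
Proof.
move=> l0 glip gl ginv gsurj y0.
have cg : continuous g.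
  move=> t; apply/cvg_ballP => e e0.
  apply: filterS (nbhsx_ballx t e e0) => u tu.
  by rewrite ballEmdist/= (le_lt_trans (glip _ _)).
have ds : dense (range (fun n => g (ratr (odflt 0 (unpickle n : option rat))))).
  move=> A [x Ax] oA; have [t tx] := gsurj x.
  have [] := @dense_rat R (g @^-1` A).
  - by exists t; rewrite /= tx.
  - by move/continuousP : cg; exact.
  move=> z [Az [q _ qz]]; exists (g z); split => //.
  by exists (pickle q) => //; rewrite pickleK /= qz.
pose k y t := expR (- mdist (g t) y).
have ck y : continuous (k y).
  move=> t; apply: continuous_comp; last exact: continuous_expR.
  apply: continuousN; apply/cvgrPdist_lt => e e0.
  apply: filterS (nbhsx_ballx t e e0) => s; apply: le_lt_trans.
  have h1 := metric_triangle (g t) (g s) y.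
  have h2 := metric_triangle (g s) (g t) y.
  have := glip t s; have := glip s t.
  by rewrite (distrC s) ler_norml => h3 h4; apply/andP; split; lra.
have kint y : lebesgue_measure.-integrable `[0, l[%classic (EFin \o k y).
  apply: integrableS (continuous_itv_integrable 0 l (ck y)) => //.
  exact: subset_itv_co_cc.
pose c := \int[lebesgue_measure]_(t in `[0, l]) k (g 0) t.
have kc y : \int[lebesgue_measure]_(t in `[0, l[) k y t = c.
  have [u <-] := gsurj y.
  rewrite Rintegral_itv_bndo_bndc; last exact: kint.
  rewrite /c -(@Rintegral_periodic _ (k (g 0)) _ (- u))//.
    by apply: eq_Rintegral => t _; rewrite /k -(ginv (t - u) 0 u) subrK add0r.
  by move=> t; rewrite /k gl.
rewrite kc.
have c0 : 0 < c.
  (* Every point of the curve is at distance at most l from g 0. *)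
  have k0_ge t : t \in `[0, l] -> expR (- l) <= k (g 0) t.
    rewrite in_itv/= => /andP[t0 tl]; rewrite ler_expR lerN2.
    by rewrite (le_trans (glip _ _))// subr0 ger0_norm.
  apply: (@lt_le_trans _ _ (expR (- l) * l)).
    by rewrite mulr_gt0// expR_gt0.
  have -> : expR (- l) * l =
      \int[lebesgue_measure]_(t in `[0, l]) cst (expR (- l)) t.
    by rewrite Rintegral_cst//= lebesgue_measure_itv/= lte_fin l0 oppr0 addr0.
  apply: le_Rintegral => //.
  - exact: (continuous_itv_integrable 0 l (@cst_continuous _ _ (expR (- l)))).
  - exact: continuous_itv_integrable.
have muI : @lebesgue_measure R `[0%R, l[%classic = l%:E.
  by rewrite lebesgue_measure_itv/= lte_fin l0 oppr0 adde0.
have l_fin : (@lebesgue_measure R `[0%R, l[%classic < +oo)%E.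
  by rewrite muI ltry.
have [p [pT pint]] :=
  finite_image_measure (mu := lebesgue_measure) (measurable_itv `[0, l[) l_fin
  (continuous_borel_measurable cg).
have pl : p setT = l%:E := etrans pT muI.
rewrite (_ : l = fine (p setT)); last by rewrite pl.
apply: (magnitude_constant_potential ds) => // y.
rewrite pint; last 2 first.
- exact: measurable_exp_kernel_l.
- by move=> x; exact: exp_kernel_ge0.
by rewrite -(kc y) fineK//; apply: integrable_fin_num (kint y).
Qed.

(** * The two metrics on the circle *)

Lemma circle_param_periodic (R : realType) (l t : R) :
  0 < l -> circle_param l (t + l) = circle_param l t.
Proof.
move=> l0; have pi0 := pi_gt0 R.
have lr : l / Defs.radius l = pi *+ 2.
  by rewrite /Defs.radius invf_div mulrCA divff ?gt_eqF// mulr1 mulr_natl.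
by apply: val_inj; rewrite /= mulrDl lr sinD2pi cosD2pi.
Qed.

(** Rotation acts on the arcs joining two points, so both distances are infima
    of the same set of lengths. *)
Lemma arc_dist_shift (R : realType) (l s t w : R) :
  arc_dist (circle_param l (s + w)) (circle_param l (t + w)) =
  arc_dist (circle_param l s) (circle_param l t).
Proof.
have shift a b v : circle_param l a = circle_param l b ->
    circle_param l (a + v) = circle_param l (b + v).
  move=> /esym/(circle_param_shift (b + v)) <-; congr circle_param; ring.
congr inf; apply/seteqP; split => _ [a [b [sa tb ->]]].
  exists (a - w), (b - w); split; last by congr `|_|; ring.
  - by rewrite (shift _ _ _ sa) addrK.
  - by rewrite (shift _ _ _ tb) addrK.
exists (a + w), (b + w); split; last by congr `|_|; ring.
- exact: shift.
- exact: shift.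
Qed.

Lemma normr_sin_le (R : realType) (x : R) : `|sin x| <= `|x|.
Proof.
wlog x0 : x / 0 <= x => [h|].
  have [/h//|/ltW x0] := leP 0 x.
  by rewrite -normrN -sinN -(normrN x) h ?oppr_ge0.
have [|z _] := @MVT_segment R sin cos 0 x x0.
  exact/continuous_subspaceT/continuous_sin.
by rewrite sin0 !subr0 => ->; rewrite normrM ler_piMl// cos_max.
Qed.

(** The half-angle formula for a chord shows at once that its length depends
    only on [s - t] and that it is at most the length of the arc. *)
Lemma chord_distE (R : realType) (l s t : R) :
  chord_dist (circle_param l s) (circle_param l t) =
  `|2 * Defs.radius l * sin ((s - t) / Defs.radius l / 2)|.
Proof.
rewrite /chord_dist -sqrtr_sqr; congr Num.sqrt => /=.
have [x xE] : exists x, (s - t) / Defs.radius l = x *+ 2.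
  by exists ((s - t) / Defs.radius l / 2); rewrite -mulr_natr divfK.
have := cosB (s / Defs.radius l) (t / Defs.radius l).
rewrite -mulrBl xE cos_mulr2n cos2sin2.
rewrite (_ : x *+ 2 / 2 = x); last by rewrite -mulr_natr mulfK.
have := cos2Dsin2 (s / Defs.radius l); have := cos2Dsin2 (t / Defs.radius l).
move: (Defs.radius l) (cos _) (sin _) (cos _) (sin _) (sin x) => r c d a b z.
move=> cd ab abcd.
transitivity (r ^+ 2 *
  ((a ^+ 2 + b ^+ 2) + (c ^+ 2 + d ^+ 2) - 2 * (c * a + d * b))); first by ring.
by rewrite cd ab -abcd; ring.
Qed.

Lemma chord_dist_le (R : realType) (l s t : R) : 0 < l ->
  chord_dist (circle_param l s) (circle_param l t) <= `|s - t|.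
Proof.
move=> l0; have r0 : 0 < Defs.radius l by rewrite divr_gt0// mulr_gt0// pi_gt0.
rewrite chord_distE normrM gtr0_norm; last exact: mulr_gt0.
rewrite (le_trans (ler_wpM2l _ (normr_sin_le _)))//.
  by rewrite mulr_ge0// ltW.
rewrite 2!normrM 2!normfV (gtr0_norm r0) normr_nat.
rewrite le_eqVlt; apply/orP; left; apply/eqP; field.
by rewrite gt_eqF.
Qed.

Theorem theorem5 (R : realType) (l : R) (l_gt0 : 0 < l) :
  (forall y : arc_circle l,
     has_magnitude (arc_circle l)
       (l / \int[lebesgue_measure]_(t in `[0, l[)
              expR (- mdist (circle_param l t : arc_circle l) y))) /\
  (forall y : chord_circle l,
     has_magnitude (chord_circle l)
       (l / \int[lebesgue_measure]_(t in `[0, l[)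
              expR (- mdist (circle_param l t : chord_circle l) y))).
Proof.
split.
  apply: (@magnitude_closed_curve R (arc_circle l) (circle_param l) l l_gt0).
  - exact: arc_dist_le.
  - by move=> t; exact: circle_param_periodic.
  - exact: arc_dist_shift.
  - exact: circle_paramP.
apply: (@magnitude_closed_curve R (chord_circle l) (circle_param l) l l_gt0).
- by move=> s t; exact: chord_dist_le.
- by move=> t; exact: circle_param_periodic.
- move=> s t w; rewrite [LHS]chord_distE [RHS]chord_distE.
  by have -> : s + w - (t + w) = s - t by ring.
- exact: circle_paramP.
Qed.
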